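(* Let $X$ be a finite-dimensional topological vector space. Then every linearly continuous function $f:X\to\mathbb R$ is of the first Baire class.
   Context: All topological vector spaces are over the field $\mathbb R$ and are assumed to be Hausdorff. A function $f:X\to Y$ from a topological vector space $X$ to a topological space $Y$ is linearly continuous if for any $x,v\in X$ the function $\mathbb R\to Y$, $t\mapsto f(x+tv)$, is continuous. A function $f:X\to Y$ between topological spaces is of the first Baire class if $f$ is a pointwise limit of a sequence of continuous functions from $X$ to $Y$. *)

(* Defs.v *)
From HB Require Import structures.
From mathcomp Require Import all_boot all_order all_algebra.
From mathcomp Require Import all_classical all_reals all_analysis.
Import Order.TTheory GRing.Theory Num.Theory.
Import numFieldNormedType.Exports.

Set Implicit Arguments.
Unset Strict Implicit.
Unset Printing Implicit Defensive.

Local Open Scope classical_set_scope.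
Local Open Scope ring_scope.

Definition finite_dimensional (R : realType) (X : lmodType R) : Prop :=
  exists (n : nat) (e : 'I_n -> X),
    forall x : X, exists c : 'I_n -> R, x = \sum_(i < n) c i *: e i.

Definition linearly_continuous (R : realType) (X : topologicalLmodType R)
    (Y : topologicalType) (f : X -> Y) : Prop :=
  forall x v : X, continuous (fun t : R => f (x + t *: v)).

Definition first_baire_class (X Y : topologicalType) (f : X -> Y) : Prop :=
  exists g : nat -> X -> Y,
    (forall n, continuous (g n)) /\
    (forall x : X, g n x @[n --> \oo] --> f x).

(* Main.v *)
Require Import Defs.
From mathcomp Require Import all_boot all_order all_algebra.
From mathcomp Require Import all_classical all_reals all_analysis.
Import numFieldNormedType.Exports.
From mathcomp Require Import ring.
Import Order.TTheory GRing.Theory Num.Theory.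

Set Implicit Arguments.
Unset Strict Implicit.
Unset Printing Implicit Defensive.

(** The approximations are averages of f over small parallelepipeds.

    For a bounded linearly continuous g, the mean
    [line_mean v g x] of g over the segment from x to x + v is again bounded
    by the same constant and linearly continuous, by dominated convergence.
    It is moreover Lipschitz along v: moving x by t v changes the segment of
    integration only at its two ends, over a total parameter length of at most
    2|t|.
    Taking further means in other directions does not spoil a Lipschitz
    estimate.  Hence, for a basis e_1, ..., e_n of X and r > 0, the iterated
    mean of g in the directions r e_1, ..., r e_n is Lipschitz along each e_i.
    It is therefore continuous ([lipschitz_along_continuous]), because in a
    Hausdorff space points near 0 have small coordinates
    ([coordinates_near0]).

    As r goes to 0 these means converge to g at every point x.  The iterated
    mean is an n-fold integral of g (x + r u) over the u in the unit
    parallelepiped.  For each fixed u the integrand tends to g x, since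
    x + r u approaches x along a line, and dominated convergence applies to
    one integral at a time ([iter_mean_cvg]).  Iterating the one-dimensional
    means keeps every integrand a continuous function of one real variable.

    An unbounded f is first composed with y / (1 + |y|), whose inverse is
    then applied to the approximations, shrunk slightly so as to stay in the
    open interval ]-1, 1[ ([first_baire_class_unsquash]). *)

Local Open Scope classical_set_scope.
Local Open Scope ring_scope.

(** * Integrals of continuous functions over intervals *)

Section continuous_integrals.
Context {R : realType}.
Notation mu := (@lebesgue_measure R).
Implicit Types (h : R -> R) (a b t : R).

Lemma continuous_itv_integrable h a b : continuous h ->
  mu.-integrable `[a, b] (EFin \o h).
Proof.
move=> hc; apply: continuous_compact_integrable; first exact: segment_compact.
exact: continuous_subspaceT.
Qed.

Lemma le_normr_Rintegral_itv h a b M : a <= b -> continuous h ->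
  (forall s, `|h s| <= M) -> `|\int[mu]_(s in `[a, b]) h s| <= M * (b - a).
Proof.
move=> ab hc hM.
have hi := continuous_itv_integrable a b hc.
apply: le_trans (le_normr_Rintegral _ hi) _ => //.
have -> : M * (b - a) = \int[mu]_(_ in `[a, b]) M.
  rewrite Rintegral_cst//= lebesgue_measure_itv/= lte_fin.
  by case: ltgtP ab => //= ->; rewrite subrr !mulr0.
apply: le_Rintegral => //.
- apply: continuous_itv_integrable => x.
  exact: cvg_norm (hc x).
- by apply: continuous_itv_integrable; exact: cst_continuous.
Qed.

Lemma Rintegral_itv_shift h a b t : a <= b -> continuous h ->
  \int[mu]_(s in `[a, b]) h (s + t) = \int[mu]_(s in `[a + t, b + t]) h s.
Proof.
move=> ab hc.
have D : derive1 (fun s : R => s + t) = cst 1.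
  by apply/funext => s; rewrite derive1E derive_val addr0.
rewrite /Rintegral; congr fine.
rewrite (@integration_by_substitution_increasing _ (fun s => s + t) h)//.
- by apply: eq_integral => x _; rewrite !fctE D mulr1.
- by move=> x y _ _; rewrite ltrD2r.
- by rewrite D => x _; exact: cst_continuous.
- by rewrite D; exact: is_cvg_cst.
- by rewrite D; exact: is_cvg_cst.
- have c x : (fun s : R => s + t) y @[y --> x] --> x + t.
    by apply: cvgD; [exact: cvg_id|exact: cvg_cst].
  split => [x _||].
  + by [].
  + exact/cvg_at_right_filter/c.
  + exact/cvg_at_left_filter/c.
- exact: continuous_subspaceT.
Qed.

(** The two unit intervals `[t, 1 + t] and `[0, 1] both lie in `[0, 1 + t]; what
    remains of it are `[0, t] and `[1, 1 + t], of length t each. *)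
Lemma Rintegral_unit_shift_le h t M : 0 <= t -> continuous h ->
  (forall s, `|h s| <= M) ->
  `|\int[mu]_(s in `[0, 1]) h (s + t) - \int[mu]_(s in `[0, 1]) h s|
    <= 2 * M * t.
Proof.
move=> t0 hc hM; rewrite Rintegral_itv_shift// add0r.
have hi : mu.-integrable `[0, 1 + t] (EFin \o h).
  exact: continuous_itv_integrable.
have shift_tail c : 0 <= c -> c <= 1 + t ->
    \int[mu]_(s in `]c, 1 + t]) h s = \int[mu]_(s in `[c, 1 + t]) h s.
  move=> c0 c1; apply: Rintegral_itv_obnd_cbnd.
  by apply: integrableS hi => //; apply: subset_itvr; rewrite bnd_simp.
have t1 : t <= 1 + t by rewrite lerDr.
have t2 : 1 <= 1 + t by rewrite lerDl.
have E1 := Rintegral_itvB (x := t) hi.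
have E2 := Rintegral_itvB (x := 1) hi.
rewrite !bnd_simp shift_tail// in E1; rewrite !bnd_simp shift_tail// in E2.
have B1 := le_normr_Rintegral_itv t0 hc hM.
have B2 := le_normr_Rintegral_itv t2 hc hM.
rewrite -E1// (_ : _ - _ - _ = \int[mu]_(s in `[1, 1 + t]) h s
  - \int[mu]_(s in `[0, t]) h s); last by rewrite -E2//; ring.
apply: le_trans (ler_normB _ _) _; apply: le_trans (lerD B2 B1) _.
by rewrite le_eqVlt; apply/orP; left; apply/eqP; ring.
Qed.

(** Dominated convergence for the real-valued integral, in the form in which
    all limits below are taken. *)
Lemma cvg_Rintegral_unit (h_ : nat -> R -> R) h M :
  (forall n, continuous (h_ n)) -> continuous h ->
  (forall n s, `|h_ n s| <= M) -> (forall s, h_ n s @[n --> \oo] --> h s) ->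
  \int[mu]_(s in `[0, 1]) h_ n s @[n --> \oo] --> \int[mu]_(s in `[0, 1]) h s.
Proof.
move=> hnc hc hM hcvg.
have [|||||_ _] := @dominated_convergence _ _ R mu `[0, 1]%classic
  (measurable_itv _)
  (fun n => EFin \o h_ n) (EFin \o h) (cst M%:E).
- by move=> n; apply: (measurable_int mu); exact: continuous_itv_integrable.
- apply: (measurable_int mu); exact: continuous_itv_integrable.
- by apply: aeW => x _; apply: cvg_EFin; [exact: nearW|exact: hcvg].
- by apply: (continuous_itv_integrable (h := cst M)); exact: cst_continuous.
- by apply: aeW => x n _; rewrite /= lee_fin.
rewrite /Rintegral; set l := (X in _ --> X -> _) => cv.
apply: fine_cvg; rewrite fineK//.
by apply: integrable_fin_num => //; exact: continuous_itv_integrable.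
Qed.

End continuous_integrals.

(** * Means along segments *)

Section line_means.
Context {R : realType} {X : topologicalLmodType R}.
Notation mu := (@lebesgue_measure R).
Implicit Types (g : X -> R) (v w x e : X) (es : seq X) (s t C M : R).

Definition line_mean v g x : R := \int[mu]_(s in `[0, 1]) g (x + s *: v).

Definition iter_mean es g : X -> R := foldr line_mean g es.

Definition lipschitz_along v C g :=
  forall x (t : R), `|g (x + t *: v) - g x| <= C * `|t|.

Lemma line_mean_le v g M : linearly_continuous g ->
  (forall x, `|g x| <= M) -> forall x, `|line_mean v g x| <= M.
Proof.
move=> gc gM x.
have := le_normr_Rintegral_itv ler01 (gc x v) (fun s => gM (x + s *: v)).
by rewrite subr0 mulr1.
Qed.

(** Along any line, the integrand depends continuously on the position for each
    value of the integration parameter; bounded convergence does the rest. *)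
Lemma line_mean_lincont v g M : linearly_continuous g ->
  (forall x, `|g x| <= M) -> linearly_continuous (line_mean v g).
Proof.
move=> gc gM x w t; apply/(@cvg_nbhsP _ R^o) => u ut; rewrite /line_mean.
apply: (cvg_Rintegral_unit (M := M)) => //= s.
under eq_fun do rewrite addrAC.
rewrite addrAC.
exact: continuous_cvg (gc (x + s *: v) w t) ut.
Qed.

(** Averaging along v turns mere continuity along v into a Lipschitz bound that
    depends only on a bound for g: the gain of regularity on which everything
    rests. *)
Lemma line_mean_lipschitz v g M : linearly_continuous g ->
  (forall x, `|g x| <= M) -> lipschitz_along v (2 * M) (line_mean v g).
Proof.
move=> gc gM.
have pos x t : 0 <= t ->
    `|line_mean v g (x + t *: v) - line_mean v g x| <= 2 * M * t.
  move=> t0; have -> : line_mean v g (x + t *: v) =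
      \int[mu]_(s in `[0, 1]) g (x + (s + t) *: v).
    by apply: eq_Rintegral => s _; rewrite scalerDl addrA addrAC.
  exact: Rintegral_unit_shift_le t0 (gc x v) (fun s => gM (x + s *: v)).
move=> x t; have [t0|t0] := leP 0 t.
  by rewrite (ger0_norm t0); exact: pos.
rewrite (ltr0_norm t0) distrC; have := pos (x + t *: v) (- t).
by rewrite scaleNr addrK; apply; rewrite oppr_ge0 ltW.
Qed.

Lemma line_mean_lipschitz_along v w C g : linearly_continuous g ->
  lipschitz_along v C g -> lipschitz_along v C (line_mean w g).
Proof.
move=> gc gL x t; rewrite /line_mean -RintegralB//; last 2 first.
- exact: continuous_itv_integrable (gc _ _).
- exact: continuous_itv_integrable (gc _ _).
rewrite -[leRHS]mulr1 -[X in _ * X]subr0.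
apply: (le_normr_Rintegral_itv
  (h := fun s => g (x + t *: v + s *: w) - g (x + s *: w))) => //.
- by move=> s; apply: cvgB; exact: gc.
- by move=> s; rewrite addrAC; exact: gL.
Qed.

Lemma iter_mean_bounded_lincont es g M : linearly_continuous g ->
  (forall x, `|g x| <= M) ->
  linearly_continuous (iter_mean es g) /\ forall x, `|iter_mean es g x| <= M.
Proof.
move=> gc gM; elim: es => //= v es [IHc IHM]; split.
- exact: line_mean_lincont IHM.
- exact: line_mean_le.
Qed.

Lemma iter_mean_lipschitz es g M v : linearly_continuous g ->
  (forall x, `|g x| <= M) -> v \in es ->
  lipschitz_along v (2 * M) (iter_mean es g).
Proof.
move=> gc gM; elim: es => //= w es IH; rewrite inE.
have [sc sM] := iter_mean_bounded_lincont es gc gM.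
move=> /predU1P[->|/IH]; first exact: line_mean_lipschitz.
exact: line_mean_lipschitz_along.
Qed.

(** The base point x + r n *: v is allowed to move, in an arbitrary direction v:
    integrating once more, in the direction e, replaces v by v + t *: e, so
    that the induction hypothesis applies to the integrand. *)
Lemma iter_mean_cvg es g M (r : nat -> R) : linearly_continuous g ->
  (forall x, `|g x| <= M) -> r n @[n --> \oo] --> 0 ->
  forall x v, iter_mean [seq r n *: e | e <- es] g (x + r n *: v)
    @[n --> \oo] --> g x.
Proof.
move=> gc gM r0 x; elim: es => [v|e es IH v] /=.
  have := cvg_comp _ _ r0 (gc x v 0).
  by rewrite scale0r addr0.
have bl n := iter_mean_bounded_lincont [seq r n *: e | e <- es] gc gM.
have -> : g x = \int[mu]_(s in `[0, 1]) cst (g x) s.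
  rewrite Rintegral_cst//= lebesgue_measure_itv/= lte_fin ltr01/=.
  by rewrite subr0 mulr1.
rewrite /line_mean; apply: (cvg_Rintegral_unit (M := M)) => /=.
- by move=> n; have [+ _] := bl n; apply.
- exact: cst_continuous.
- by move=> n t; have [_] := bl n; apply.
- move=> t; have := IH (v + t *: e); under eq_fun do
    rewrite scalerDr scalerA mulrC -scalerA addrA; exact.
Qed.

End line_means.

(** * Coordinates in a finite-dimensional Hausdorff space *)

Definition spanning (R : realType) (X : lmodType R) n (e : 'I_n -> X) :=
  forall x, exists c : 'I_n -> R, x = \sum_(i < n) c i *: e i.

Definition independent (R : realType) (X : lmodType R) n (e : 'I_n -> X) :=
  forall c : 'I_n -> R, \sum_(i < n) c i *: e i = 0 -> forall i, c i = 0.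

(** A spanning family of minimal size is independent, since a vector with a
    nonzero coefficient in a relation could be dropped. *)
Lemma finite_dimensional_basis (R : realType) (X : lmodType R) :
  finite_dimensional X ->
  exists n (e : 'I_n -> X), spanning e /\ independent e.
Proof.
move=> fX.
have exP : exists n, `[< exists e : 'I_n -> X, spanning e >].
  by have [n eP] := fX; exists n; exact/asboolP.
have [n /asboolP[e espan] nmin] := ex_minnP exP.
exists n, e; split => // c c0 j; apply/eqP/negPn/negP => cj0.
case: n e espan nmin c c0 j cj0 => [|n] e espan nmin c c0 j cj0.
  by case: j cj0.
suff : spanning (e \o lift j).
  move=> sp; have := nmin n; rewrite ltnn => /(_ _)/notF; apply.
  by apply/asboolP; exists (e \o lift j).
have ej : e j = \sum_(i < n) (- (c j)^-1 * c (lift j i)) *: e (lift j i).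
  move: c0; rewrite (bigD1_ord j)//= => /eqP; rewrite addr_eq0 => /eqP ce.
  have -> : e j = (c j)^-1 *: (c j *: e j) by rewrite scalerA mulVf// scale1r.
  rewrite ce scalerN -scaleNr scaler_sumr; apply: eq_bigr => i _.
  by rewrite scalerA.
move=> x; have [a ->] := espan x.
exists (fun i => a (lift j i) + a j * (- (c j)^-1 * c (lift j i))).
rewrite (bigD1_ord j)//= {1}ej scaler_sumr addrC -big_split.
apply: eq_bigr => i _ /=.
by rewrite scalerDl scalerA.
Qed.

Section coordinates.
Context {R : realType} {X : topologicalLmodType R}.
Implicit Types (x v : X) (n : nat).

Lemma lincomb_continuous n (e : 'I_n -> X) :
  continuous (fun c : 'rV[R]_n => \sum_(i < n) c 0 i *: e i).
Proof.
move=> c.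
apply: (@cvg_big _ _ _ _ _ (@add_continuous X) _ _ _ _ _ (nbhs_filter c)).
move=> i _.
apply: (@continuous_comp _ (R^o * X)%type _ (fun c : 'rV[R]_n => (c 0 i, e i))
  (fun z => z.1 *: z.2)); last exact: scale_continuous.
apply: (@cvg_pair _ _ _ _ (nbhs (c 0 i : R^o)) (nbhs (e i)));
  [exact: nbhs_filter c|exact: coord_continuous|].
by apply: cvg_cst; exact: nbhs_filter c.
Qed.

(** The image K of the unit sphere of R^n is compact, hence closed in the
    Hausdorff space X, and misses 0 by independence.  If a *: w avoids K for
    |a| < r and w in a neighbourhood W of 0, no point of W can have coordinates
    of norm c > 1 / r, since dividing such a point by c lands in K.
    Rescaling W gives any bound d in place of 1 / r. *)
Lemma coordinates_near0 n (e : 'I_n -> X) (d : R) : hausdorff_space X ->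
  independent e -> 0 < d ->
  \forall x \near (0 : X), forall c : 'I_n -> R,
    x = \sum_(i < n) c i *: e i -> forall i, `|c i| <= d.
Proof.
move=> hX indep d0.
pose phi (c : 'rV[R]_n) := \sum_(i < n) c 0 i *: e i.
have phiZ a c : phi (a *: c) = a *: phi c.
  by rewrite /phi scaler_sumr; apply: eq_bigr => i _; rewrite mxE scalerA.
pose S := [set c : 'rV[R]_n | `|c| = 1].
have Scompact : compact S.
  apply: bounded_closed_compact.
    by exists 1; split => // M M1 c /= ->; exact: ltW.
  apply: (@closed_comp _ _ (fun c : 'rV[R]_n => `|c|) [set 1]) => [c _|].
    exact: norm_continuous.
  exact: closed_eq.
have Kclosed : closed (phi @` S).
  apply: compact_closed => //; apply: continuous_compact => //.
  by apply: continuous_subspaceT; exact: lincomb_continuous.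
have V0 : nbhs (0 : X) (~` (phi @` S)).
  apply: open_nbhs_nbhs; split; first exact: closed_openC.
  move=> [c cS /indep c0]; suff : c = 0.
    move=> cE; move: cS; rewrite /S/= cE normr0 => /eqP.
    by rewrite eq_sym oner_eq0.
  by apply/rowP => i; rewrite mxE; exact: c0.
have := @scale_continuous R X (0, 0) _; rewrite /= scaler0 => /(_ _ V0).
move=> [[A W] /= [/nbhs_ballP[r /= r0 rA] W0] AW].
have bound c : W (phi c) -> `|c| <= r^-1.
  move=> Wc; rewrite leNgt; apply/negP => rc.
  have c0 : 0 < `|c| by apply: lt_trans rc; rewrite invr_gt0.
  apply: (AW (`|c|^-1, phi c)) => /=.
    split => //; apply: rA; rewrite /ball/= sub0r normrN normfV normr_id.
    by rewrite invf_plt.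
  exists (`|c|^-1 *: c); last exact: phiZ.
  by rewrite /S/= normrZ normfV normr_id mulVf// gt_eqF.
pose k := (d * r)^-1.
have k0 : 0 < k by rewrite invr_gt0 mulr_gt0.
have : nbhs (0 : X) ( *:%R k @^-1` W).
  have := @scale_continuous R X (k, 0) W; rewrite /= scaler0 => /(_ W0).
  move=> [[B C] /= [/nbhs_singleton Bk C0] BC]; apply: filterS C0 => y Cy.
  exact: (BC (k, y)).
apply: filterS => x Wx c xE i.
pose c' := \row_j c j.
have xE' : x = phi c' by rewrite xE; apply: eq_bigr => j _; rewrite mxE.
move: Wx; rewrite /= xE' -phiZ => /bound; rewrite normrZ gtr0_norm//.
rewrite /k ler_pdivrMl ?mulr_gt0// mulfK ?gt_eqF//; apply: le_trans.
have -> : c i = c' 0 i by rewrite mxE.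
rewrite [leRHS]/Num.norm /= mx_normrE.
exact: (le_bigmax _ (fun j => `|c' j.1 j.2|) (0, i)).
Qed.

Lemma lipschitz_along_sum n (e : 'I_n -> X) (g : X -> R) C (c : 'I_n -> R) x :
  (forall i, lipschitz_along (e i) C g) ->
  `|g (x + \sum_(i < n) c i *: e i) - g x| <= \sum_(i < n) C * `|c i|.
Proof.
move=> gL; elim/big_ind2 : _ x => [x|r1 s1 r2 s2 IH1 IH2 x|i _ x].
- by rewrite addr0 subrr normr0.
- apply: le_trans (ler_distD (g (x + s1)) _ _) _.
  by rewrite addrC addrA lerD.
- exact: gL.
Qed.

Lemma lipschitz_along_continuous n (e : 'I_n -> X) (g : X -> R) C :
  hausdorff_space X -> spanning e -> independent e ->
  (forall i, lipschitz_along (e i) C g) -> continuous g.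
Proof.
move=> hX espan indep gL x; apply/cvgrPdist_le => eps eps0.
(* n |C| times the bound for the coordinates must be at most eps; adding 1
   makes the divisor positive. *)
pose D := n%:R * `|C| + 1.
have D0 : 0 < D by rewrite ltr_wpDl// mulr_ge0.
have /(coordinates_near0 hX indep) near0 : 0 < eps / D by rewrite divr_gt0.
have xsub : y - x @[y --> x] --> (0 : X).
  rewrite -(subrr x).
  apply: (@continuous_comp _ (X * X)%type _ (fun y => (y, x))
    (fun z => z.1 - z.2)); last exact: sub_continuous.
  apply: (@cvg_pair _ _ _ _ (nbhs x) (nbhs x)); first exact: cvg_id.
  exact: cvg_cst.
have : nbhs x (fun y => forall c : 'I_n -> R, y - x = \sum_(i < n) c i *: e i ->
    forall i, `|c i| <= eps / D) := xsub _ near0.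
apply: filterS => y yd.
have [c cE] := espan (y - x).
have yE : y = x + \sum_(i < n) c i *: e i by rewrite -cE addrC subrK.
rewrite distrC [in g y]yE.
apply: le_trans (lipschitz_along_sum c x gL) _.
apply: (@le_trans _ _ (\sum_(i < n) `|C| * (eps / D))).
  apply: ler_sum => i _; apply: (@le_trans _ _ (`|C| * `|c i|)).
    by rewrite ler_wpM2r// ler_norm.
  by rewrite ler_wpM2l//; exact: yd.
rewrite sumr_const card_ord -mulrnAl -mulr_natl mulrCA ger_pMr//.
by rewrite ler_pdivrMr// mul1r lerDl.
Qed.

End coordinates.

(** * Reduction to bounded functions *)

Section bounded_functions.
Context {R : realType}.

Definition squash (y : R) : R := y / (1 + `|y|).

Lemma squash_den_gt0 (y : R) : 0 < 1 + `|y|.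
Proof. by rewrite ltr_pwDl. Qed.

Lemma norm_squash (y : R) : `|squash y| = `|y| / (1 + `|y|).
Proof. by rewrite normrM normfV (gtr0_norm (squash_den_gt0 y)). Qed.

Lemma norm_squash_lt1 (y : R) : `|squash y| < 1.
Proof. by rewrite norm_squash ltr_pdivrMr ?squash_den_gt0// mul1r ltrDr. Qed.

Lemma squashK (y : R) : squash y / (1 - `|squash y|) = y.
Proof.
have d0 := squash_den_gt0 y; rewrite norm_squash /squash.
by field; rewrite addrK oner_eq0 gt_eqF.
Qed.

Lemma squash_continuous : continuous squash.
Proof.
move=> y; apply: cvgM; first exact: cvg_id.
apply: cvgV; first by rewrite gt_eqF ?squash_den_gt0.
by apply: cvgD; [exact: cvg_cst|apply: cvg_norm; exact: cvg_id].
Qed.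

(** The inverse y / (1 - |y|) of [squash] blows up at 1 and -1, values that the
    G k may reach; the factors c k, which increase to 1, keep them away from
    there without changing the limit. *)
Lemma first_baire_class_unsquash (X : topologicalType) (f : X -> R)
    (G : nat -> X -> R) :
  (forall k, continuous (G k)) -> (forall k x, `|G k x| <= 1) ->
  (forall x, G k x @[k --> \oo] --> squash (f x)) -> first_baire_class f.
Proof.
move=> Gc G1 Gf.
pose c k : R := 1 - k.+1%:R^-1.
have c0 k : 0 <= c k by rewrite subr_ge0 invf_le1// ler1n.
have c1 k : c k < 1 by rewrite ltrBlDr ltrDl invr_gt0.
have ccvg : c k @[k --> \oo] --> (1 : R).
  rewrite -[X in _ --> X]subr0; apply: cvgB; first exact: cvg_cst.
  exact: cvg_harmonic.
have cG1 k x : 1 - `|c k * G k x| != 0.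
  rewrite gt_eqF// subr_gt0 normrM ger0_norm//.
  by apply: le_lt_trans (c1 k); rewrite ler_piMr.
exists (fun k x => (c k * G k x) / (1 - `|c k * G k x|)); split.
- move=> k x.
  have cGx : (fun x => c k * G k x) y @[y --> x] --> c k * G k x.
    by apply: cvgM; [exact: cvg_cst|exact: Gc].
  apply: cvgM => //; apply: cvgV; first exact: cG1.
  by apply: cvgB; [exact: cvg_cst|exact: cvg_norm].
- move=> x; rewrite -[X in _ --> X](squashK (f x)).
  have cGx : (fun k => c k * G k x) k @[k --> \oo] --> squash (f x).
    by rewrite -[X in _ --> X]mul1r; apply: cvgM; [exact: ccvg|exact: Gf].
  apply: cvgM => //; apply: cvgV.
    by rewrite gt_eqF// subr_gt0 norm_squash_lt1.
  by apply: cvgB; [exact: cvg_cst|exact: cvg_norm].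
Qed.

End bounded_functions.

(** * Linearly continuous functions *)

(* [topologicalLmodType R] does not assume local convexity, unlike the library's
   [tvsType], nor separation. *)
Theorem theorem1p1 (R : realType) (X : topologicalLmodType R)
  (X_hausdorff : hausdorff_space X) (X_findim : finite_dimensional X)
  (f : X -> R) (f_lincont : linearly_continuous f) : first_baire_class f.
Proof.
have [n [e [espan eindep]]] := finite_dimensional_basis X_findim.
pose F x := squash (f x).
have Fc : linearly_continuous F.
  move=> x v t.
  apply: (@continuous_comp R R R (fun t => f (x + t *: v)) squash).
    exact: f_lincont.
  exact: squash_continuous.
have F1 x : `|F x| <= 1 by rewrite ltW ?norm_squash_lt1.
pose r k : R := k.+1%:R^-1.
pose G k := iter_mean [seq r k *: v | v <- codom e] F.
have G1 k x : `|G k x| <= 1.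
  exact: (iter_mean_bounded_lincont [seq r k *: v | v <- codom e] Fc F1).2.
apply: (first_baire_class_unsquash (G := G)) => // [k|x].
- apply: (lipschitz_along_continuous (C := 2 / r k) X_hausdorff espan eindep).
  move=> i x t; have r0 : 0 < r k by rewrite invr_gt0.
  (* t e_i is a multiple, by t / r k, of the direction r k e_i of a mean *)
  have /(_ x (t / r k)) :=
    iter_mean_lipschitz Fc F1 (map_f ( *:%R (r k)) (codom_f e i)).
  rewrite scalerA divfK ?gt_eqF// normrM normfV (gtr0_norm r0) mulr1.
  by rewrite mulrA mulrAC.
- have := @iter_mean_cvg _ _ (codom e) F 1 r Fc F1 (@cvg_harmonic R) x 0.
  by under eq_fun do rewrite scaler0 addr0; exact.
Qed.
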